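(* Let $A\in\mathbb{C}^{n\times n}$ with $\operatorname{ind}(A)=k$ and let $X$ be a minimal rank weak Drazin inverse of $A$. Then the following statements are equivalent: (1) $A^{\dagger}AXA=AXAA^{\dagger}$; (2) $A^{\dagger}AXAA^{\dagger}=A^{D,\dagger}$ and $A^{\dagger}AXAA^{\dagger}=A^{\dagger,D}$; (3) $A^{\dagger}AXAA^{\dagger}=A^{D}=A^{D,\dagger}=A^{\dagger,D}$; (4) $XAA^{\dagger}=A^{D}$ and $A^{\dagger}A^{k+1}=A^{k}$.
   Context: $A^{\dagger}$ is the Moore–Penrose inverse of $A$. The index $\operatorname{ind}(A)$ is the smallest nonnegative integer $k$ such that $\operatorname{rank}(A^k)=\operatorname{rank}(A^{k+1})$. $A^{D}$ is the Drazin inverse of $A$: the unique $T$ with $TAT=T$, $AT=TA$, $A^{k+1}T=A^k$ where $k=\operatorname{ind}(A)$. The DMP inverse of $A$ is $A^{D,\dagger}=A^{D}AA^{\dagger}$ and the MPD inverse of $A$ is $A^{\dagger,D}=A^{\dagger}AA^{D}$. A matrix $X\in\mathbb{C}^{n\times n}$ is a minimal rank weak Drazin inverse of $A$ if $XA^{j+1}=A^{j}$ for some $j\in\mathbb{N}$ and $\operatorname{rank}(X)=\operatorname{rank}(A^{D})$. For a fixed such $X$, $A^{\dagger}AXAA^{\dagger}$ is called the weak CMP inverse of $A$. *)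

(* Defs.v *)
From mathcomp Require Import all_boot all_order all_algebra.
From mathcomp Require Import reals complex.

Set Implicit Arguments.
Unset Strict Implicit.
Unset Printing Implicit Defensive.

Import Order.TTheory GRing.Theory Num.Theory.
Local Open Scope ring_scope.
Local Open Scope sesquilinear_scope.

Section GeneralizedInverses.
Variable C : numClosedFieldType.

(* [M ^t*] is the conjugate transpose of M (see [spectral]). *)
Definition is_mpinv m n (A : 'M[C]_(m, n)) (X : 'M[C]_(n, m)) : bool :=
  [&& A *m X *m A == A, X *m A *m X == X,
      (A *m X)^t* == A *m X & (X *m A)^t* == X *m A].

Lemma trmxC_mul m n p (A : 'M[C]_(m, n)) (B : 'M[C]_(n, p)) :
  (A *m B)^t* = B^t* *m A^t*.
Proof. by rewrite trmx_mul map_mxM. Qed.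

Lemma mulmx_trmxC_eq0 m n (A : 'M[C]_(m, n)) : A *m A^t* = 0 -> A = 0.
Proof.
move=> AA0; apply/matrixP=> i j; rewrite mxE.
have /eqP := congr1 (fun M : 'M[C]_m => M i i) AA0; rewrite !mxE.
rewrite psumr_eq0 => [/allP/(_ j (mem_index_enum j))|k _]; rewrite !mxE.
  by rewrite mul_conjC_eq0 => /eqP.
exact: mul_conjC_ge0.
Qed.

Lemma row_free_gram_unit m n (A : 'M[C]_(m, n)) :
  row_free A -> A *m A^t* \in unitmx.
Proof.
move=> freeA; rewrite -row_free_unit -kermx_eq0; apply/eqP.
set K := kermx _; have : K *m A *m (K *m A)^t* = 0.
  by rewrite trmxC_mul mulmxA -(mulmxA K) mulmx_ker mul0mx.
by move/mulmx_trmxC_eq0/eqP; rewrite mulmx_free_eq0 // => /eqP.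
Qed.

Lemma mpinv_exists m n (A : 'M[C]_(m, n)) : exists X, is_mpinv A X.
Proof.
have [r [B [D [defA fullB freeD]]]] : exists r (B : 'M_(m, r)) (D : 'M_(r, n)),
    [/\ A = B *m D, row_full B & row_free D].
  exists (\rank A), (col_base A), (row_base A).
  by rewrite mulmx_base col_base_full row_base_free.
pose G := D *m D^t*; pose H := B^t* *m B.
have uG : G \in unitmx by exact: row_free_gram_unit.
have uH : H \in unitmx.
  have := @row_free_gram_unit _ _ (B^t*); rewrite trmxCK; apply.
  by rewrite row_free_map /row_free mxrank_tr.
have hG : G^t* = G by rewrite trmxC_mul trmxCK.
have hH : H^t* = H by rewrite trmxC_mul trmxCK.
have hV (K : 'M[C]_r) : K^t* = K -> (invmx K)^t* = invmx K.
  by move=> hK; rewrite trmx_inv map_invmx hK.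
pose X := D^t* *m invmx G *m invmx H *m B^t*.
have AX : A *m X = B *m invmx H *m B^t*.
  by rewrite defA /X !mulmxA -(mulmxA B D) -/G -(mulmxA B G) mulmxV // mulmx1.
have XA : X *m A = D^t* *m invmx G *m D.
  by rewrite defA /X !mulmxA -(mulmxA _ (B^t*) B) -/H -(mulmxA _ (invmx H) H)
    mulVmx // mulmx1.
exists X; apply/and4P; split; apply/eqP.
- by rewrite AX defA !mulmxA -(mulmxA _ (B^t*) B) -/H -(mulmxA B) mulVmx // mulmx1.
- by rewrite XA /X !mulmxA -(mulmxA _ D (D^t*)) -/G -(mulmxA _ (invmx G) G)
    mulVmx // mulmx1.
- by rewrite AX !trmxC_mul trmxCK hV // mulmxA.
- by rewrite XA !trmxC_mul trmxCK hV // mulmxA.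
Qed.

Lemma mpinv_unique m n (A : 'M[C]_(m, n)) (X Y : 'M[C]_(n, m)) :
  is_mpinv A X -> is_mpinv A Y -> X = Y.
Proof.
case/and4P=> /eqP X1 /eqP X2 /eqP X3 /eqP X4.
case/and4P=> /eqP Y1 /eqP Y2 /eqP Y3 /eqP Y4.
have eAX : A *m X = A *m Y.
  by rewrite -{1}Y1 -mulmxA -X3 -Y3 -trmxC_mul mulmxA X1 Y3.
have eXA : X *m A = Y *m A.
  by rewrite -{1}Y1 -(mulmxA A) mulmxA -X4 -Y4 -trmxC_mul -mulmxA (mulmxA A) X1 Y4.
by rewrite -X2 -mulmxA eAX mulmxA eXA Y2.
Qed.

Definition mpinv m n (A : 'M[C]_(m, n)) : 'M[C]_(n, m) :=
  xchoose (mpinv_exists A).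

Lemma mpinvP m n (A : 'M[C]_(m, n)) : is_mpinv A (mpinv A).
Proof. exact: xchooseP. Qed.

Variable n : nat.
Implicit Types A X T : 'M[C]_n.

Lemma ind_exists A : exists k, \rank (A ^+ k) == \rank (A ^+ k.+1).
Proof.
have [/existsP[k] rk|/existsPn noK] :=
  boolP [exists k : 'I_n.+1, \rank (A ^+ k) == \rank (A ^+ k.+1)].
  by exists k.
suff dec k : (k <= n.+1)%N -> (\rank (A ^+ k) + k <= n)%N.
  by have := dec _ (leqnn _); rewrite addnS ltnNge leq_addl.
elim: k => [_|k IHk lt_k]; first by rewrite addn0 rank_leq_row.
apply: leq_trans (IHk (ltnW lt_k)); rewrite addnS ltn_add2r ltn_neqAle.
by rewrite eq_sym (noK (Ordinal lt_k)) exprS mxrankM_maxr.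
Qed.

Definition ind A : nat := ex_minn (ind_exists A).

Lemma rank_ind A : \rank (A ^+ ind A) = \rank (A ^+ (ind A).+1).
Proof. by rewrite /ind; case: ex_minnP => k /eqP. Qed.

Definition is_drazin A T : bool :=
  [&& T *m A *m T == T, A *m T == T *m A
    & A ^+ (ind A).+1 *m T == A ^+ ind A].

Lemma drazin_exists A : exists T, is_drazin A T.
Proof.
set k := ind A.
have [Y AY] : exists Y, A ^+ k = Y * A ^+ k.+1.
  have sub : (A ^+ k.+1 <= A ^+ k)%MS by rewrite exprS submxMl.
  by apply/submxP; rewrite -(mxrank_leqif_sup sub) rank_ind.
have [Z AZ] : exists Z, A ^+ k = A ^+ k.+1 * Z.
  have sub : ((A ^+ k.+1)^T <= (A ^+ k)^T)%MS by rewrite exprSr trmx_mul submxMl.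
  have /submxP[Z defZ] : ((A ^+ k)^T <= (A ^+ k.+1)^T)%MS.
    by rewrite -(mxrank_leqif_sup sub) !mxrank_tr rank_ind.
  by exists Z^T; apply: trmx_inj; rewrite defZ trmx_mul trmxK.
have AYn j : A ^+ k = Y ^+ j * A ^+ (k + j).
  elim: j => [|j IHj]; first by rewrite expr0 mul1r addn0.
  by rewrite exprSr addnS -addSn exprD mulrA -(mulrA _ Y) -AY -mulrA -exprD.
have AZn j : A ^+ k = A ^+ (j + k) * Z ^+ j.
  elim: j => [|j IHj]; first by rewrite expr0 mulr1.
  by rewrite exprS addSn -addnS exprD mulrA -(mulrA _ _ Z) -AZ -exprD.
have T2 j : A ^+ k * Z ^+ j = Y ^+ j * A ^+ k.
  by rewrite {1}(AYn j) -mulrA addnC -AZn.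
pose T := A ^+ k * Z ^+ k.+1; exists T.
have AT : A * T = A ^+ k * Z ^+ k.
  by rewrite /T exprS !mulrA -exprS -AZ.
have TA : T * A = Y ^+ k * A ^+ k.
  by rewrite /T T2 -mulrA -exprSr exprSr -mulrA -AY.
have com : A * T = T * A by rewrite AT TA T2.
apply/and3P; split; apply/eqP; rewrite ?mulmxE //.
- by rewrite TA {1}/T mulrA -(mulrA (Y ^+ k)) -exprD -AYn.
- have comk j : A ^+ j * T = T * A ^+ j by apply/esym; apply: commrX; exact/esym.
  by rewrite comk /T T2 -mulrA -exprD -AYn.
Qed.

Lemma drazin_unique A T T' : is_drazin A T -> is_drazin A T' -> T = T'.
Proof.
set k := ind A.
have aux S : is_drazin A S -> [/\ A * S = S * A, A ^+ k.+1 * S = A ^+ k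
    & forall j, S = A ^+ j * S ^+ j.+1].
  case/and3P=> /eqP S1 /eqP S2 /eqP S3; split=> //.
  have com : A * S = S * A by [].
  elim=> [|j IHj]; first by rewrite expr0 mul1r.
  have S1' : S * A * S = S by [].
  rewrite exprSr exprS (exprS S j) !mulrA -(mulrA _ A S) com.
  by rewrite -(mulrA _ (S * A) S) S1' -mulrA -exprS.
move=> /aux[cT AT dT] /aux[cT' AT' dT'].
have cTk j : A ^+ j * T = T * A ^+ j
  by apply/esym; apply: commrX; exact/esym.
have cTkk i j : A ^+ i * T ^+ j = T ^+ j * A ^+ i
  by apply: commrX; exact: cTk.
transitivity (T * A * T').
  by rewrite {1}(dT k) cTkk -{1}AT' (exprSr A) !mulrA -cTkk -dT.
by rewrite [RHS](dT' k) -{1}AT cTk (exprS A) {1}(dT' k) !mulrA.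
Qed.

Definition drazin A : 'M[C]_n := xchoose (drazin_exists A).

Lemma drazinP A : is_drazin A (drazin A).
Proof. exact: xchooseP. Qed.

Definition dmp A : 'M[C]_n := drazin A *m A *m mpinv A.
Definition mpd A : 'M[C]_n := mpinv A *m A *m drazin A.

Definition min_rank_weak_drazin A X : Prop :=
  (exists j : nat, X *m A ^+ j.+1 = A ^+ j) /\ \rank X = \rank (drazin A).

End GeneralizedInverses.

(* Main.v *)
Require Import Defs.
From mathcomp Require Import all_boot all_order all_algebra.
From mathcomp Require Import reals complex.

(** Write D for the Drazin inverse and P for the Moore-Penrose inverse of A.
    A minimal rank weak Drazin inverse X has the same column space as D, which
    gives X A D = D and D A X = X. Each of the four conditions then amounts to
    X A = D A together with D A P = D = P A D. *)

Import GRing.Theory.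

Local Open Scope ring_scope.

Section RingInverses.
Set Implicit Arguments.
Unset Strict Implicit.
Variables (R : pzRingType) (a d : R).
Hypotheses (dad : d * a * d = d) (ad : a * d = d * a).

Lemma drazin_mulX j : d = a ^+ j * d ^+ j.+1.
Proof.
elim: j => [|j IHj]; first by rewrite expr0 mul1r.
rewrite exprSr !(exprS d) !mulrA -(mulrA _ a) ad.
by rewrite -(mulrA _ (d * a)) dad -mulrA -exprS.
Qed.

Lemma drazin_exprM j : d ^+ j.+1 * a ^+ j.+1 = d * a.
Proof.
rewrite -exprMn_comm; last exact/esym.
elim: j => [|j IHj]; first by rewrite expr1.
by rewrite exprS IHj mulrA dad.
Qed.

Variables (x : R) (j : nat).
Hypothesis xaj : x * a ^+ j.+1 = a ^+ j.

(** Writing [d] as [a ^+ j * d ^+ j.+1] supplies the power of [a] that [xaj] needs. *)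
Lemma weak_drazin_fix : x * a * d = d.
Proof.
by rewrite {1}(drazin_mulX j) mulrA -(mulrA x) -exprS xaj -drazin_mulX.
Qed.

Hypothesis dax : d * a * x = x.

(** Here [x * a = d * a * x * a = d * (x * a) * a]. After [j.+1] rounds the power of [a] on the
    right lets [xaj] eliminate [x], leaving [d ^+ j.+1 * a ^+ j.+1]. *)
Lemma weak_drazin_comm : x * a * a = a * x * a -> x * a = d * a.
Proof.
move=> xaa; have step m : x * a = d ^+ m * (x * a) * a ^+ m.
  elim: m => [|m {1}->]; first by rewrite !expr0 mul1r mulr1.
  rewrite -{1}dax (exprSr d) (exprS a) -!mulrA.
  by do 2!congr (_ * _); rewrite !mulrA xaa.
rewrite (step j.+1) -!mulrA -exprS (exprSr a) (mulrA x) xaj -exprSr.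
exact: drazin_exprM.
Qed.

Variables (p : R) (k : nat).
Hypotheses (apa : a * p * a = a) (dak : d * a ^+ k.+1 = a ^+ k).

(** Only ring identities remain here: the rank condition is encoded in [dax]. *)
Lemma weak_cmp_tfae :
  [<-> p * a * x * a = a * x * a * p;
       p * a * x * a * p = d * a * p /\ p * a * x * a * p = p * a * d;
       [/\ p * a * x * a * p = d, d = d * a * p & d * a * p = p * a * d];
       x * a * p = d /\ p * a ^+ k.+1 = a ^+ k].
Proof.
have xad := weak_drazin_fix.
have add : a * d * d = d by rewrite ad.
have wapa w : w * a * p * a = w * a by rewrite -!(mulrA w) apa.
have pax : p * a * d = d -> p * a * x = x.
  by move=> pad; rewrite -dax !mulrA pad.
tfae.
- move=> paxa.
  have pad : p * a * d = d.
    (* The factor [d] is written [a * d * d] so that, on the right, its leading [a] absorbs [p]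
       through [apa]. *)
    have := congr1 (fun y => y * (a * d * d)) paxa.
    rewrite /= {1}add -(mulrA (p * a)) -(mulrA (p * a)) xad => ->.
    by rewrite !mulrA wapa -(mulrA a) -(mulrA a) xad.
  rewrite (pax pad) in paxa *.
  (* [paxa] now reads [x * a = a * x * a * p]; multiplying by [a] on the right removes [p]. *)
  have xa : x * a = d * a by apply: weak_drazin_comm; rewrite {1}paxa wapa.
  rewrite xa pad; split=> //.
  have := congr1 ( *%R d) paxa.
  rewrite -(mulrA a) xa !mulrA dad => <-.
  by rewrite -mulrA -ad mulrA dad.
- move=> [-> dap_pad].
  (* Left multiplication by [d * a] fixes [d * a * p] and sends [p * a * d] to [d]. *)
  have dap : d * a * p = d.
    have := congr1 (fun y => d * (a * y)) dap_pad.
    by rewrite /= !mulrA dad wapa dad.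
  by rewrite -dap_pad dap.
- move=> [paxap dap dap_pad].
  have pad : p * a * d = d by rewrite -dap_pad.
  rewrite (pax pad) in paxap; split=> //.
  by rewrite exprS mulrA -dak mulrA pad.
- move=> [xap pak].
  have pad : p * a * d = d.
    by rewrite (drazin_mulX k) mulrA -(mulrA p) -exprS pak.
  have xa : x * a = d * a by rewrite -xap wapa.
  (* Both sides reduce to [d * a]: the left is [x * a], the right is [a * d]. *)
  by rewrite (pax pad) xa -(mulrA a) -(mulrA a) xap ad.
Qed.

End RingInverses.

(* X A D = D puts the column space of D inside that of X, and
   the rank condition makes the two equal. *)
Lemma min_rank_weak_drazin_range (C : numClosedFieldType) n (A X : 'M[C]_n) :
  min_rank_weak_drazin A X -> drazin A * A * X = X.
Proof.
case=> -[j XAj] rX; have /and3P[/eqP DAD /eqP AD _] := drazinP A.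
have sub : ((drazin A)^T <= X^T)%MS.
  by rewrite -(weak_drazin_fix DAD AD XAj) -mulrA -mulmxE trmx_mul submxMl.
have /submxP[W defX] : (X^T <= (drazin A)^T)%MS.
  by rewrite -(mxrank_leqif_sup sub) !mxrank_tr rX.
have -> : X = drazin A * W^T by apply: trmx_inj; rewrite defX trmx_mul trmxK.
by rewrite mulrA -!mulmxE DAD.
Qed.

Theorem theorem3p10 (R : realType) (n k : nat) (A X : 'M[R[i]]_n)
    (indA : ind A = k) (hX : min_rank_weak_drazin A X) :
  [<-> mpinv A *m A *m X *m A = A *m X *m A *m mpinv A;
       mpinv A *m A *m X *m A *m mpinv A = dmp A /\
         mpinv A *m A *m X *m A *m mpinv A = mpd A;
       [/\ mpinv A *m A *m X *m A *m mpinv A = drazin A,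
           drazin A = dmp A & dmp A = mpd A];
       X *m A *m mpinv A = drazin A /\ mpinv A *m A ^+ k.+1 = A ^+ k].
Proof.
have DAX := min_rank_weak_drazin_range hX; have [[j XAj] _] := hX.
have /and3P[/eqP DAD /eqP AD /eqP AkD] := drazinP A.
have /and4P[/eqP APA _ _ _] := mpinvP A.
have DAk : drazin A * A ^+ k.+1 = A ^+ k.
  by rewrite -indA -[RHS]AkD; apply: commrX; apply/esym.
exact: (weak_cmp_tfae DAD AD XAj DAX APA DAk).
Qed.
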